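(* Let $G$ be a connected graph and $U\subset V(G)$. Then $U$ has an envelope $U^*$ such that $G[U^*]$ is connected and $U^*\cap V(C)$ induces a connected subgraph for every component $C$ of $G-U$. Moreover, if $U$ is concentrated, then such a $U^*$ can additionally be chosen to be concentrated.
   Context: Ends: a ray is a one-way infinite path; two rays are equivalent if for every finite $X\subset V(G)$ they have tails in the same component of $G-X$; the classes are the ends. For finite $X$ and an end $\varepsilon$, $C(X,\varepsilon)$ is the component of $G-X$ containing tails of all rays of $\varepsilon$. An end $\varepsilon$ lies in the closure of a vertex set $M$ if $C(X,\varepsilon)$ meets $M$ for every finite $X\subset V(G)$; $\partial M$ (written $|M|$ in the paper) denotes the set of ends in the closure of $M$. An adhesion set of $U\subset V(G)$ is a set $N(C)$ for a component $C$ of $G-U$; $U$ has finite adhesion if all its adhesion sets are finite. An envelope for $U$ is a set $U^*\supseteq U$ of finite adhesion with $\partial U^*=\partial U$. A set $U$ is concentrated if for every finite $X\subset V(G)$ only finitely many vertices of $U$ lie outside $\bigcup_{\varepsilon\in\partial U}C(X,\varepsilon)$. *)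

(* Defs.v *)
From Stdlib Require Import Relation_Operators.
From mathcomp Require Import all_boot.
From mathcomp Require Import boolp classical_sets functions cardinality.

Set Implicit Arguments.
Unset Strict Implicit.
Unset Printing Implicit Defensive.

Local Open Scope classical_set_scope.

(* Simple graphs of arbitrary cardinality. *)
Record sgraph := SGraph {
  vertex :> Type;
  adj : vertex -> vertex -> Prop;
  adj_sym : forall x y, adj x y -> adj y x;
  adj_irrefl : forall x, ~ adj x x
}.

(* Subgraphs are always induced here, hence given by their vertex sets:
   [W] stands for G[W], and [~` X] for G - X. *)
Section Connectivity.
Variable G : sgraph.
Implicit Types (x y : G) (W C : set G).

Definition joined W : G -> G -> Prop :=
  clos_refl_trans G (fun x y => [/\ W x, W y & adj x y]).

(* The empty graph is not connected.  Hence the requirement that U* meets a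
   component C of G - U in a connected subgraph is only imposed when U* meets
   C: if U is the centre of an infinite star, every concentrated envelope of U
   is finite and so misses infinitely many components of G - U. *)
Definition connected_set W : Prop :=
  W !=set0 /\ forall x y, W x -> W y -> joined W x y.

Definition is_component W C : Prop :=
  exists2 x, W x & C = [set y | W y /\ joined W x y].

Definition neighborhood C : set G :=
  [set v | ~ C v /\ exists2 c, C c & adj c v].

End Connectivity.

Record ray (G : sgraph) := Ray {
  ray_vertex :> nat -> G;
  ray_inj : injective ray_vertex;
  ray_adj : forall n, adj (ray_vertex n) (ray_vertex n.+1)
}.

Section Ends.
Variable G : sgraph.
Implicit Types (r s : ray G) (e : set (ray G)) (U W X C : set G).

Definition has_tail_in r C : Prop :=
  exists n, forall i, n <= i -> C (r i).

Definition ray_equiv r s : Prop :=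
  forall X, finite_set X ->
    exists C, [/\ is_component (~` X) C, has_tail_in r C & has_tail_in s C].

Definition is_end e : Prop := exists r, e = [set s | ray_equiv r s].

(* C(X, e): for X finite and e an end, exactly one component of G - X
   contains tails of all rays of e, so this union is that component. *)
Definition end_component X e : set G :=
  \bigcup_(C in [set C | is_component (~` X) C /\
                         forall r, e r -> has_tail_in r C]) C.

Definition end_boundary U : set (set (ray G)) :=
  [set e | is_end e /\
    forall X, finite_set X -> end_component X e `&` U !=set0].

Definition finite_adhesion U : Prop :=
  forall C, is_component (~` U) C -> finite_set (neighborhood C).

Definition is_envelope U W : Prop :=
  [/\ U `<=` W, finite_adhesion W & end_boundary W = end_boundary U].

Definition concentrated U : Prop :=
  forall X, finite_set X ->
    finite_set (U `\` \bigcup_(e in end_boundary U) end_component X e).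

End Ends.

(* Main.v *)
(* For w in W and a finite set X, consider the requirement that w is joined in
   G - X to a vertex of U.  If for every finite X it fails only for finitely many
   w, then W has the same ends in its closure as U, and W is concentrated if U is.
   This relation between W and U ([closely_surrounds]) is transitive, and U* is
   obtained in three steps that respect it.
   First add a maximal family of disjoint rays whose ends lie in the closure of U.
   Then add all vertices that no finite set separates from what we have: now an
   infinite adhesion set N(C) would produce, by a star-comb argument, one more ray
   in C with end in the closure of U.
   Finally, for each of the (finite) adhesion sets F choose one component C with
   N(C) = F and add a finite connected subset of C adjacent to all of F. *)
Require Import Defs.
From Stdlib Require Import Relation_Operators Operators_Properties.
From mathcomp Require Import all_boot.
From mathcomp Require Import boolp classical_sets functions cardinality.

Set Implicit Arguments.
Unset Strict Implicit.
Unset Printing Implicit Defensive.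

Local Open Scope classical_set_scope.

(** * Finite sets *)

Lemma finite_powerset (T : Type) (X : set T) :
  finite_set X -> finite_set [set F | F `<=` X].
Proof.
move=> /(@finite_seqP {classic T})[s ->].
pose f (m : (size s).-tuple bool) : set T := [set` mask m s].
apply: sub_finite_set (finite_image f (finite_finset (X := setT))) => F sF.
have sz : size [seq `[< F x >] | x <- s] == size s by rewrite size_map.
exists (Tuple sz) => //; rewrite /f /= -filter_mask.
apply/seteqP; split => x /=; rewrite mem_filter; first by case/andP => /asboolP.
by move=> Fx; rewrite sF // andbT; apply/asboolP.
Qed.

Lemma finite_set_bounded (T : Type) (X : set T) (d : T -> nat) :
  finite_set X -> exists n, forall x, X x -> d x < n.
Proof.
move=> /(finite_image d)/finite_seqP[s sE].
exists (\max_(i <- s) i).+1 => x Xx; rewrite ltnS.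
apply: (leq_bigmax_seq (d x)) => //.
have : [set` s] (d x) by rewrite -sE; exists x.
by [].
Qed.

(** * Walks, components and neighborhoods *)

Section Joined.
Variable G : sgraph.
Implicit Types (x y z : G) (W X A B : set G).

Lemma joined1 W x y : W x -> W y -> adj x y -> joined W x y.
Proof. by move=> Wx Wy xy; apply: rt_step. Qed.

Lemma joined_refl W x : joined W x x.
Proof. exact: rt_refl. Qed.

Lemma joined_trans W y x z : joined W x y -> joined W y z -> joined W x z.
Proof. exact: rt_trans. Qed.

Lemma joined_sym W x y : joined W x y -> joined W y x.
Proof.
elim=> [a b [Wa Wb ab]|a|a b c _ ba _ cb].
- by apply: joined1 => //; apply: adj_sym.
- exact: joined_refl.
- exact: joined_trans cb ba.
Qed.

Lemma sub_joined W A x y : W `<=` A -> joined W x y -> joined A x y.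
Proof.
move=> WA; elim=> [a b [Wa Wb ab]|a|a b c _ ab _ bc].
- by apply: joined1 => //; apply: WA.
- exact: joined_refl.
- exact: joined_trans ab bc.
Qed.

Lemma joined_closed W A x y :
  (forall a b, A a -> W a -> W b -> adj a b -> A b) ->
  joined W x y -> A x -> A y.
Proof.
move=> clA /(clos_rt_rtn1 _ _ _ _); elim=> // a b [Wa Wb ab] _ IH Ax.
exact: clA (IH Ax) Wa Wb ab.
Qed.

Lemma joined_mem W x y : joined W x y -> W x -> W y.
Proof. exact: joined_closed. Qed.

Definition comp W x : set G := [set y | W y /\ joined W x y].

Lemma comp_refl W x : W x -> comp W x x.
Proof. by split=> //; apply: joined_refl. Qed.

Lemma comp_eq W x y : comp W x y -> comp W x = comp W y.
Proof.
move=> [Wy xy]; apply/seteqP; split=> z [Wz xz]; split=> //.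
- exact: joined_trans (joined_sym xy) xz.
- exact: joined_trans xy xz.
Qed.

Lemma componentE W A x : is_component W A -> A x -> A = comp W x.
Proof. by move=> [z _ ->] /(@comp_eq W z x). Qed.

Lemma is_component_comp W x : W x -> is_component W (comp W x).
Proof. by move=> Wx; exists x. Qed.

Lemma component_sub W A : is_component W A -> A `<=` W.
Proof. by move=> [z _ ->] x []. Qed.

Lemma component_adj W A x y :
  is_component W A -> A x -> W y -> adj x y -> A y.
Proof.
move=> cA Ax Wy xy; rewrite (componentE cA Ax); split=> //.
by apply: joined1 => //; apply: component_sub Ax.
Qed.

Lemma neighborhood_sub W C : is_component (~` W) C -> neighborhood C `<=` W.
Proof.
move=> cC a [Ca [c Cc ca]]; apply: contrapT => Wa; apply: Ca.
exact: component_adj cC Cc Wa ca.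
Qed.

Lemma joined_component W A x y :
  is_component W A -> joined W x y -> A x -> joined A x y.
Proof.
move=> cA /(clos_rt_rtn1 _ _ _ _) xy Ax.
suff [] : A y /\ joined A x y by [].
elim: xy => [|a b [Wa Wb ab] _ [Aa xa]]; first by split=> //; apply: joined_refl.
have Ab := component_adj cA Aa Wb ab.
by split=> //; apply: joined_trans xa (joined1 Aa Ab ab).
Qed.

Lemma component_joined W A x y :
  is_component W A -> A x -> A y -> joined A x y.
Proof.
move=> cA Ax; rewrite {1}(componentE cA Ax) => -[_ xy].
exact: joined_component xy Ax.
Qed.

Lemma joined_finite_path W x y : W x -> joined W x y ->
  exists P, [/\ finite_set P, P `<=` W, P x, P y &
                forall z, P z -> joined P x z].
Proof.
move=> Wx /(clos_rt_rtn1 _ _ _ _); elim=> [|a b [Wa Wb ab] _ [P [fP PW Px Pa jP]]].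
  exists [set x]; split=> [||||_ ->] //; last exact: joined_refl.
  by move=> _ ->.
exists (P `|` [set b]); split.
- by rewrite finite_setU; split=> //; apply: finite_set1.
- by move=> z [/PW //|->].
- by left.
- by right.
- have sP : P `<=` P `|` [set b] by move=> z; left.
  move=> z [Pz|->]; first exact: sub_joined sP (jP z Pz).
  apply: joined_trans (sub_joined sP (jP a Pa)) _.
  by apply: joined1 => //; [left | right].
Qed.

End Joined.

(** * Ends in the closure of a vertex set *)

Section Rays.
Variable G : sgraph.
Implicit Types (r s : ray G) (e : set (ray G)) (U W X K : set G).

Lemma ray_tail r X : finite_set X ->
  exists n, forall i, n <= i -> ~ X (r i).
Proof.
move=> fX; have fI : finite_set (r @^-1` X).
  by apply: finite_preimage fX => i j _ _; apply: ray_inj.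
have [n nP] := finite_set_bounded id fI.
by exists n => i ni Xi; have := nP i Xi; rewrite ltnNge ni.
Qed.

Lemma ray_joined r W m n :
  (forall i, m <= i -> W (r i)) -> m <= n -> joined W (r m) (r n).
Proof.
move=> Wr; elim: n => [|n IH]; first by rewrite leqn0 => /eqP ->; apply: joined_refl.
rewrite leq_eqVlt => /orP[/eqP ->|mn]; first exact: joined_refl.
apply: joined_trans (IH mn) (joined1 _ _ (ray_adj r n)); apply: Wr => //.
exact: leqW.
Qed.

(** The end of [r] lies in the closure of [U], expressed through tails of a single ray instead of
    components; [end_boundaryE] is the translation. *)
Definition converges r U := forall X, finite_set X ->
  exists n u, [/\ forall i, n <= i -> ~ X (r i), U u, ~ X u &
                  joined (~` X) (r n) u].

(** Two tails of [r] that avoid [X] meet further along the ray, so any such tail can replace the one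
    that convergence provides. *)
Lemma convergesE r U X m : converges r U -> finite_set X ->
  (forall i, m <= i -> ~ X (r i)) ->
  exists u, [/\ U u, ~ X u & joined (~` X) (r m) u].
Proof.
move=> rU fX mX; have [n [u [nX Uu Xu nu]]] := rU X fX; exists u; split=> //.
apply: joined_trans _ nu.
have mk := @ray_joined r (~` X) _ _ mX (leq_maxl _ _).
have nk := @ray_joined r (~` X) _ _ nX (leq_maxr _ _).
exact: joined_trans (mk n) (joined_sym (nk m)).
Qed.

Lemma ray_equiv_refl r : ray_equiv r r.
Proof.
move=> X fX; have [n nX] := ray_tail r fX.
have tail : has_tail_in r (comp (~` X) (r n)).
  by exists n => i ni; split; [exact: nX | exact: ray_joined].
by exists (comp (~` X) (r n)); split=> //; apply: is_component_comp; apply: nX.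
Qed.

(** A component of G - X that contains a tail of [r] shares a vertex with that of [r n], so the
    union has a single member. *)
Lemma end_componentE r X n : finite_set X -> (forall i, n <= i -> ~ X (r i)) ->
  end_component X [set s | ray_equiv r s] = comp (~` X) (r n).
Proof.
move=> fX nX.
have tailE C : is_component (~` X) C -> has_tail_in r C -> C = comp (~` X) (r n).
  move=> cC [m mC]; rewrite (componentE (x := r n) cC) //.
  rewrite (componentE (x := r (maxn m n)) cC); last exact/mC/leq_maxl.
  split; first exact: nX.
  apply: joined_sym; apply: ray_joined nX _; exact: leq_maxr.
apply/seteqP; split=> v.
  by move=> [C /= [cC eC] Cv]; rewrite -(tailE C cC) //; apply/eC/ray_equiv_refl.
move=> rv; exists (comp (~` X) (r n)) => //=; split.
  by apply: is_component_comp; apply: nX.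
by move=> s /(_ X fX)[C [cC rC sC]]; rewrite -(tailE C).
Qed.

Lemma end_boundaryE U :
  end_boundary U = [set [set s | ray_equiv r s] | r in [set r | converges r U]].
Proof.
apply/seteqP; split.
  move=> _ [[r ->] cl]; exists r => //= X fX.
  have [n nX] := ray_tail r fX; have [u []] := cl X fX.
  by rewrite (end_componentE fX nX) => -[Xu nu] Uu; exists n, u; split.
move=> _ [r rU <-]; split; first by exists r.
move=> X fX; have [n nX] := ray_tail r fX.
have [u [Uu Xu nu]] := convergesE rU fX nX.
by exists u; split=> //; rewrite (end_componentE fX nX).
Qed.

Definition closely_surrounds W U := forall X, finite_set X ->
  exists2 K, finite_set K & forall w, W w -> ~ K w ->
    exists u, [/\ U u, ~ X u & joined (~` X) w u].

(** Deleting the exceptional set [K] along with [X] makes the walk from [w] end at a vertex of [V]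
    that is not exceptional, from which it continues to [U]. The next lemmas enlarge [X] for the
    same purpose. *)
Lemma closely_surrounds_trans V U W :
  closely_surrounds V U -> closely_surrounds W V -> closely_surrounds W U.
Proof.
move=> VU WV X fX; have [K fK KP] := VU X fX.
have fXK : finite_set (X `|` K) by rewrite finite_setU.
have [L fL LP] := WV _ fXK; exists L => // w Ww Lw.
have [v [Vv /not_orP[_ Kv] wv]] := LP w Ww Lw.
have [u [Uu Xu vu]] := KP v Vv Kv; exists u; split=> //.
by apply: joined_trans _ vu; apply: sub_joined wv; apply: subsetC; apply: subsetUl.
Qed.

Lemma converges_surrounds r U W :
  closely_surrounds W U -> converges r W -> converges r U.
Proof.
move=> WU rW X fX; have [K fK KP] := WU X fX.
have fXK : finite_set (X `|` K) by rewrite finite_setU.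
have [n [w [nX Ww /not_orP[_ Kw] nw]]] := rW _ fXK.
have [u [Uu Xu wu]] := KP w Ww Kw.
exists n, u; split=> //; first by move=> i /nX /not_orP[].
by apply: joined_trans _ wu; apply: sub_joined nw; apply: subsetC; apply: subsetUl.
Qed.

Lemma end_boundary_surrounds U W : U `<=` W -> closely_surrounds W U ->
  end_boundary W = end_boundary U.
Proof.
move=> UW WU; rewrite !end_boundaryE; congr image.
apply/seteqP; split=> r /= rC; first exact: converges_surrounds rC.
by move=> X /rC[n [u [nX /UW Wu Xu nu]]]; exists n, u.
Qed.

Lemma concentrated_surrounds U W : U `<=` W -> closely_surrounds W U ->
  concentrated U -> concentrated W.
Proof.
move=> UW WU cU X fX.
rewrite (@end_boundary_surrounds U W) //.
set good := \bigcup_(_ in _) _; have fB := cU X fX; rewrite -/good in fB.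
(* As [U] is concentrated, its vertices outside [good] can be deleted too. The vertex of [U] reached
   from [w] is then in [good], and [w] is in its component of G - X. *)
have fXB : finite_set (X `|` (U `\` good)) by rewrite finite_setU.
have [K fK KP] := WU _ fXB; apply: sub_finite_set fK => w [Ww gw].
apply: contrapT => Kw; have [u [Uu /not_orP[Xu Bu] wu]] := KP w Ww Kw.
have {}wu : joined (~` X) w u.
  by apply: sub_joined wu; apply: subsetC; apply: subsetUl.
have [e eU [C [cC eC] Cu]] : good u by apply: contrapT => gu; apply: Bu.
apply: gw; exists e => //; exists C => //.
rewrite (componentE cC Cu); split; last exact: joined_sym.
exact: joined_mem (joined_sym wu) Xu.
Qed.

End Rays.

(** * Enlarging a set to finite adhesion *)

Section FiniteAdhesion.
Variable G : sgraph.
Implicit Types (r : ray G) (R : set (ray G)) (U W X C : set G).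

Lemma surrounds_rays U R : (forall r, R r -> converges r U) ->
  trivIset R (fun r : ray G => range r) ->
  closely_surrounds (U `|` \bigcup_(r in R) range r) U.
Proof.
move=> RU tR X fX.
(* The initial segment, up to [x], of the ray through [x]. Disjointness allows only one such ray, so
   the segment is finite. From any other vertex of a ray, the rest of the ray avoids [X]. *)
pose before x := [set v | exists r i j, [/\ R r, i <= j, v = r i & x = r j]].
exists (X `|` \bigcup_(x in X) before x).
  rewrite finite_setU; split=> //; apply: bigcup_finite => // x _.
  have [[r [j [Rr ->]]]|nx] := pselect (exists r j, R r /\ x = r j); last first.
    apply: sub_finite_set (finite_set0 _) => v [r [i [j [Rr _ _ xE]]]].
    by apply: nx; exists r, j.
  apply: sub_finite_set (finite_image r (finite_II j.+1)).
  move=> _ [s [i [k [Rs ik -> rs]]]].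
  have sr : s = r by apply: tR => //; exists (r j); split; [exists k | exists j].
  by subst s; exists i => //; move/ray_inj: rs => ->.
move=> w [Uw|[r Rr [i _ <-]]] /not_orP[Xw nw].
  by exists w; split=> //; apply: joined_refl.
apply: (convergesE (RU r Rr) fX) => j ij Xj.
by apply: nw; exists (r j) => //; exists r, i, j.
Qed.

(** Equivalently, [U] together with the vertices that send infinitely many paths to [U], disjoint
    apart from their common start. *)
Definition inseparable U : set G := [set v | forall X, finite_set X -> ~ X v ->
  exists2 u, U u & joined (~` X) v u].

Lemma sub_inseparable U : U `<=` inseparable U.
Proof. by move=> v Uv X _ _; exists v => //; apply: joined_refl. Qed.

Lemma inseparable_idem U : inseparable (inseparable U) `<=` inseparable U.
Proof.
move=> v vU X fX Xv; have [w wU vw] := vU X fX Xv.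
have [u Uu wu] := wU X fX (joined_mem vw Xv).
by exists u => //; apply: joined_trans vw wu.
Qed.

Lemma surrounds_inseparable U : closely_surrounds (inseparable U) U.
Proof.
move=> X fX; exists X => // w wU Xw; have [u Uu wu] := wU X fX Xw.
by exists u; split=> //; apply: joined_mem wu Xw.
Qed.

(** When [d] is the distance in G[C] from a root, these are pieces of geodesics from the root; this
    order takes the place of a spanning tree. *)
Definition upward C (d : G -> nat) : G -> G -> Prop :=
  clos_refl_trans G (fun x y => [/\ C x, C y, adj x y & d y = (d x).+1]).

Lemma upward_le C d x y : upward C d x y -> d x <= d y.
Proof.
elim=> [a b [_ _ _ ->]|//|a b c _ ab _ bc]; first exact: leqnSn.
exact: leq_trans bc.
Qed.

(** Every vertex of an upward path lies between its ends in the order, so the path need not be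
    named. *)
Lemma upward_joined C d W x y :
  (forall z, upward C d x z -> upward C d z y -> W z) ->
  upward C d x y -> joined W x y.
Proof.
move=> + xy; move: (xy) => /(clos_rt_rtn1 _ _ _ _).
elim=> [|a b ab /(clos_rtn1_rt _ _ _ _) xa IH] Wz; first exact: joined_refl.
have ab1 : upward C d a b by apply: rt_step.
have Wa : W a by apply: Wz.
have Wb : W b by apply: Wz; [apply: rt_trans xa ab1 | apply: rt_refl].
apply: (joined_trans (y := a)); last by case: ab => _ _ ab _; apply: joined1.
by apply: IH => z xz za; apply: Wz => //; apply: rt_trans za ab1.
Qed.

(* The distance in G[C] from [v]. *)
Lemma distance_exists C v : (forall x, C x -> joined C v x) ->
  exists d, forall x, C x -> upward C d v x.
Proof.
move=> Cv.
(* The ends of walks of length [n] from [v] in G[C]. The least such [n] becomes [d], with the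
   arbitrary value 0 outside [C]. *)
pose reach := fix reach n : set G := if n is m.+1 then
  [set y | exists x, [/\ reach m x, C x, C y & adj x y]] else [set v].
have reachP x : C x -> exists n, reach n x.
  move=> /Cv/(clos_rt_rtn1 _ _ _ _); elim=> [|a b [Ca Cb ab] _ [n an]].
    by exists 0.
  by exists n.+1, a.
have minP x : exists n, C x -> reach n x /\ forall m, reach m x -> n <= m.
  have [/reachP[n xn]|nC] := pselect (C x); last by exists 0.
  have exb : exists n, `[< reach n x >] by exists n; apply/asboolP.
  case: (ex_minnP exb) => k /asboolP xk kmin; exists k => _.
  by split=> // m /asboolP; apply: kmin.
have [d dP] := choice minP; exists d => x.
move: {2}(d x) (erefl (d x)) => n; elim: n x => [|n IH] x dx Cx.
  by have [+ _] := dP x Cx; rewrite dx => /= ->; apply: rt_refl.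
have [+ xmin] := dP x Cx; rewrite dx => /= -[y [yn Cy _ yx]].
have [dy ymin] := dP y Cy.
(* A shorter walk to [y] would extend to a walk to [x] shorter than [d x]. *)
have dyn : d y = n.
  apply/eqP; rewrite eqn_leq ymin //= -ltnS -dx; apply: xmin.
  by exists y.
apply: rt_trans (IH y dyn Cy) _; apply: rt_step; split=> //.
by rewrite dx dyn.
Qed.

(* No vertex of C sends infinitely many paths, disjoint apart from that vertex,
   to N(C), for it would be inseparable from [W].  Hence a vertex above which (in
   the distance order of G[C]) infinitely many elements of N(C) are attached has
   an upper neighbor with the same property, and these vertices contain a ray. *)
Lemma comb_exists W C : inseparable W `<=` W -> is_component (~` W) C ->
  ~ finite_set (neighborhood C) ->
  exists2 r : ray G, range r `<=` C & converges r W.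
Proof.
move=> clW cC infN.
have [v Wv CE] := cC; have Cv : C v by rewrite CE; apply: comp_refl.
have [d dP] : exists d, forall x, C x -> upward C d v x.
  by apply: distance_exists => x Cx; apply: component_joined cC _ _.
have NW := neighborhood_sub cC.
pose S x := [set a | neighborhood C a /\
                     exists c, [/\ C c, adj c a & upward C d x c]].
have SUp x y : upward C d x y -> S y `<=` S x.
  move=> xy a [Na [c [Cc ca yc]]]; split=> //; exists c; split=> //.
  exact: rt_trans xy yc.
have stepP x : exists y, C x -> ~ finite_set (S x) ->
    [/\ C y, adj x y, d y = (d x).+1 & ~ finite_set (S y)].
  have [[y [Cy xy dy Sy]]|ny] := pselect (exists y,
    [/\ C y, adj x y, d y = (d x).+1 & ~ finite_set (S y)]); first by exists y.
  exists x => Cx Sx; exfalso; apply: Sx.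
  (* Since [x] is outside [W], it is not inseparable from [W]. *)
  have [X [fX Xx XW]] : exists X,
      [/\ finite_set X, ~ X x & forall u, W u -> ~ joined (~` X) x u].
    apply: contrapT => nX; apply: (component_sub cC Cx); apply: clW => X fX Xx.
    apply: contrapT => nu; apply: nX; exists X; split=> // u Wu xu.
    by apply: nu; exists u.
  (* An upward path from [x] that leads to an element of N(C) outside [X] must meet [X] in some [s]
     other than [x], hence above an upper neighbor [y] of [x]. Then [above s] is part of [S y],
     which is finite by [ny]. *)
  pose above s := [set a | S s a /\ exists y,
    [/\ C y, adj x y, d y = (d x).+1 & upward C d y s]].
  apply: (@sub_finite_set _ _ (X `|` \bigcup_(s in X) above s)); last first.
    rewrite finite_setU; split=> //; apply: bigcup_finite => // s _.
    have [[y [Cy xy dy ys]]|ns] := pselect (exists y,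
      [/\ C y, adj x y, d y = (d x).+1 & upward C d y s]); last first.
      by apply: sub_finite_set (finite_set0 _) => a [_ /ns].
    have : finite_set (S y) by apply: contrapT => nf; apply: ny; exists y.
    by apply: sub_finite_set => a [/(SUp _ _ ys)].
  move=> a [Na [c [Cc ca xc]]]; apply: contrapT => /not_orP[Xa na].
  have avoid z : upward C d x z -> upward C d z c -> ~ X z.
    move=> xz zc Xz; apply: na; exists z => //; split.
      by split=> //; exists c.
    move: xz => /(clos_rt_rt1n _ _ _ _) xz; case: xz Xz zc => // y w.
    by move=> [_ Cy xy dy] /(clos_rt1n_rt _ _ _ _) yw _ _; exists y.
  apply: (XW a (NW _ Na)); apply: joined_trans (upward_joined avoid xc) _.
  by apply: joined1 => //; apply: avoid xc _; apply: rt_refl.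
have [f fP] := choice stepP; pose rv n := iter n f v.
have rvP n : C (rv n) /\ ~ finite_set (S (rv n)).
  elim: n => [|n [Cn Sn]]; last by have [] := fP _ Cn Sn.
  split=> //; apply: contra_not infN; apply: sub_finite_set => a Na.
  have [_ [c Cc ca]] := Na; split=> //; exists c; split=> //.
  exact: dP.
have rvS n : [/\ adj (rv n) (rv n.+1) & d (rv n.+1) = (d (rv n)).+1].
  by have [Cn Sn] := rvP n; have [] := fP _ Cn Sn.
have rvd n : d (rv n) = d v + n.
  by elim: n => [|n IH]; [rewrite addn0 | have [_ ->] := rvS n; rewrite IH addnS].
have rv_inj : injective rv.
  by move=> i j /(congr1 d); rewrite !rvd => /addnI.
exists (Ray rv_inj (fun n => (rvS n).1)).
  by move=> _ [n _ <-]; have [] := rvP n.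
(* All vertices above [rv n] are too far from [v] to lie in [X], and the infinite set [S (rv n)] has
   an element outside [X]. *)
move=> X fX; have [n nX] := finite_set_bounded d fX.
have upX z : upward C d (rv n) z -> ~ X z.
  move=> /upward_le nz /nX; apply/negP; rewrite -leqNgt.
  by apply: leq_trans nz; rewrite rvd leq_addl.
have [a [[Na [c [Cc ca nc]]] Xa]] : (S (rv n) `\` X) !=set0.
  apply: infinite_setN0; have [_ Sn] := rvP n.
  apply: contra_not Sn => fSX.
  apply: (@sub_finite_set _ _ ((S (rv n) `\` X) `|` X)).
    by move=> z Sz; have [?|?] := pselect (X z); [right | left].
  by rewrite finite_setU.
exists n, a; split=> //=.
- move=> i ni /nX; apply/negP; rewrite -leqNgt rvd.
  exact: leq_trans ni (leq_addl _ _).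
- exact: NW.
- apply: joined_trans (upward_joined _ nc) _; first by move=> z /upX.
  by apply: joined1 => //; apply: upX.
Qed.

Lemma finite_adhesion_exists U : exists W,
  [/\ U `<=` W, finite_adhesion W & closely_surrounds W U].
Proof.
have [R [RU tR Rmax]] := ex_maximal_disjoint_subcollection
  (fun r : ray G => range r) [set r | converges r U].
pose V := U `|` \bigcup_(r in R) range r.
have VU : closely_surrounds V U by apply: surrounds_rays.
have WU : closely_surrounds (inseparable V) U.
  by apply: closely_surrounds_trans VU _; apply: surrounds_inseparable.
exists (inseparable V); split=> //.
  by apply: subset_trans (@sub_inseparable V); apply: subsetUl.
move=> C cC; apply: contrapT => infN.
have [r rC rW] := comb_exists (@inseparable_idem V) cC infN.
(* The new ray stays in [C], which misses all rays of [R]; adding it to [R] contradicts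
   maximality. *)
have rR s : R s -> ~ (range s `&` range r !=set0).
  move=> Rs [v [sv /rC /(component_sub cC)]]; apply.
  by apply: sub_inseparable; right; exists s.
have Rr : ~ R r by move=> /rR; apply; exists (r 0); split; exists 0.
apply: (Rmax (R `|` [set r])).
- by split=> [s|/(_ r)]; [left | move=> /(_ (or_intror erefl))].
- by move=> s [/RU //|->]; apply: converges_surrounds rW.
- move=> s t [Rs|->] [Rt|->] // [v [sv tv]].
  + by apply: tR => //; exists v.
  + by case: (rR s Rs); exists v.
  + by case: (rR t Rt); exists v.
Qed.

End FiniteAdhesion.

(** * Connecting through adhesion sets *)

Section Connecting.
Variable G : sgraph.
Implicit Types (x y z : G) (U W X Y C F : set G).

Lemma sub_component U W C D x : U `<=` W -> is_component (~` U) C ->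
  is_component (~` W) D -> C x -> D x -> D `<=` C.
Proof.
move=> UW cC cD Cx Dx y Dy; rewrite (componentE cC Cx).
have DU : D `<=` ~` U by move=> z /(component_sub cD) Wz /UW.
by split; [exact: DU | exact: sub_joined DU (component_joined cD Dx Dy)].
Qed.

Lemma finite_connected_exists W C F : is_component W C -> finite_set F ->
  F `<=` neighborhood C ->
  exists T, [/\ finite_set T, connected_set T, T `<=` C &
                forall a, F a -> exists2 t, T t & adj t a].
Proof.
move=> cC fF FN; have [v Cv] : C !=set0.
  by have [v Wv ->] := cC; exists v; apply: comp_refl.
have pathP a : exists P, F a ->
    [/\ finite_set P, P `<=` C, forall z, P z -> joined P v z &
        exists2 t, P t & adj t a].
  have [/FN[_ [c Cc ca]]|nF] := pselect (F a); last by exists set0.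
  have [P [fP PC Pv Pc jP]] :=
      joined_finite_path Cv (component_joined cC Cv Cc).
  by exists P => _; split=> //; exists c.
(* Adding [v] keeps [T] nonempty when [F] is empty. *)
have [P PP] := choice pathP; pose T := [set v] `|` \bigcup_(a in F) P a.
have PT a : F a -> P a `<=` T by move=> Fa z Pz; right; exists a.
have Tv z : T z -> joined T v z.
  move=> [->|[a Fa Pz]]; first exact: joined_refl.
  by have [_ _ jP _] := PP a Fa; apply: sub_joined (PT a Fa) (jP z Pz).
exists T; split.
- rewrite finite_setU; split=> //; apply: bigcup_finite => // a Fa.
  by have [] := PP a Fa.
- split; first by exists v; left.
  by move=> x y /Tv vx /Tv; apply: joined_trans; apply: joined_sym.
- by move=> z [->//|[a Fa Pz]]; have [_ PC _ _] := PP a Fa; apply: PC.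
- move=> a Fa; have [_ _ _ [t Pt ta]] := PP a Fa.
  by exists t => //; apply: PT Pt.
Qed.

Definition adhesion_set W F :=
  exists2 C, is_component (~` W) C & neighborhood C = F.

Definition connector W F (T : set G) :=
  [/\ finite_set T, connected_set T,
      forall a, F a -> exists2 t, T t & adj t a &
      exists C, [/\ is_component (~` W) C, neighborhood C = F & T `<=` C]].

Lemma connectors_exist W : finite_adhesion W ->
  exists T, forall F, adhesion_set W F -> connector W F (T F).
Proof.
move=> faW; suff /choice[T TP] F : exists T, adhesion_set W F -> connector W F T.
  by exists T.
have [[C cC NC]|nF] := pselect (adhesion_set W F); last by exists set0.
have [|T [fT cT TC aT]] := finite_connected_exists cC (faW C cC); first by [].
by exists T => _; split=> //; [rewrite -NC | exists C].
Qed.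

Section Extension.
Variables (W : set G) (T : set G -> set G).
Hypothesis faW : finite_adhesion W.
Hypothesis TP : forall F, adhesion_set W F -> connector W F (T F).

(* One connector per adhesion set, not per component: infinitely many
   components can have the same neighborhood. *)
Definition extension := W `|` \bigcup_(F in adhesion_set W) T F.

Definition nbhd_at z := neighborhood (comp (~` W) z).

Lemma adhesion_nbhd_at z : ~ W z -> adhesion_set W (nbhd_at z).
Proof. by move=> Wz; exists (comp (~` W) z) => //; apply: is_component_comp. Qed.

(** A connector lies inside a component whose neighborhood is [F], so each of its vertices
    determines [F]. *)
Lemma connector_at F z : adhesion_set W F -> T F z -> ~ W z /\ nbhd_at z = F.
Proof.
move=> aF Tz; have [_ _ _ [C [cC NC TC]]] := TP aF.
have Cz := TC z Tz; split; first exact: component_sub cC z Cz.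
by rewrite /nbhd_at -(componentE cC Cz).
Qed.

Lemma surrounds_extension : closely_surrounds extension W.
Proof.
move=> X fX.
(* For any other adhesion set [F], the connector [T F] avoids [X] and [F] has a vertex outside [X],
   which lies in [W] and is adjacent to [T F]. *)
pose near := (nbhd_at @` X) `|` [set F | F `<=` X].
exists (X `|` \bigcup_(F in near `&` adhesion_set W) T F).
  rewrite finite_setU; split=> //; apply: bigcup_finite.
    apply/finite_setIl; rewrite finite_setU; split; first exact: finite_image.
    exact: finite_powerset.
  by move=> F [_ /TP[]].
move=> w [Ww|[F aF Tw]] /not_orP[Xw nw].
  by exists w; split=> //; apply: joined_refl.
have nF : ~ near F by move=> nF; apply: nw; exists F.
have [_ [_ Tc] Ta [C [cC NC TC]]] := TP aF.
have TX : T F `<=` ~` X.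
  by move=> x /(connector_at aF)[_ xF] Xx; apply: nF; left; exists x.
have [a [Fa Xa]] : exists a, F a /\ ~ X a.
  apply: contrapT => na; apply: nF; right => a Fa.
  by apply: contrapT => Xa; apply: na; exists a.
have [t Tt ta] := Ta a Fa.
exists a; split=> //; first by apply: (neighborhood_sub cC); rewrite NC.
apply: joined_trans (sub_joined TX (Tc w t Tw Tt)) _.
by apply: joined1 => //; apply: TX.
Qed.

(** A component [D] lies in a component C of G - W. A neighbor of [D] is either in N(C) or in C
    itself, and in the latter case it belongs to the connector of N(C). *)
Lemma finite_adhesion_extension : finite_adhesion extension.
Proof.
move=> D cD; have [x Wx DE] := cD.
have Dx : D x by rewrite DE; apply: comp_refl.
have nWx : ~ W x by move=> Wx'; apply: Wx; left.
have cC := @is_component_comp _ (~` W) x nWx; have aF := adhesion_nbhd_at nWx.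
have DC : D `<=` comp (~` W) x.
  by apply: sub_component cC cD (@comp_refl _ (~` W) x nWx) Dx; left.
have [fT _ _ _] := TP aF.
apply: (@sub_finite_set _ _ (nbhd_at x `|` T (nbhd_at x))).
  move=> v Nv; have [_ [c Dc cv]] := Nv.
  have [Wv|nWv] := pselect (W v).
    left; split; first by move/(component_sub cC).
    by exists c => //; apply: DC.
  right; have Cv := component_adj cC (DC c Dc) nWv cv.
  case: (neighborhood_sub cD Nv) => // -[F aF' Tv].
  have [_ vF] := connector_at aF' Tv.
  by rewrite /nbhd_at (comp_eq Cv) -/(nbhd_at v) vF.
by rewrite finite_setU; split=> //; apply: faW.
Qed.

(** A substitute in the extension for an arbitrary vertex [z]. It may lie in another component than
    [z], one with the same neighborhood. *)
Definition anchor z t := (W z /\ t = z) \/ (~ W z /\ T (nbhd_at z) t).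

Lemma anchor_exists z : exists t, anchor z t.
Proof.
have [Wz|Wz] := pselect (W z); first by exists z; left.
by have [_ [[t Tt] _] _ _] := TP (adhesion_nbhd_at Wz); exists t; right.
Qed.

Lemma anchor_self z : extension z -> anchor z z.
Proof.
move=> [Wz|[F aF Tz]]; first by left.
by right; have [Wz ->] := connector_at aF Tz.
Qed.

(** Replace the vertices of a walk in [Y] by anchors: anchors of adjacent vertices are joined
    through at most one connector, and the connectors used lie in [Y]. *)
Lemma connected_extension Y : connected_set Y ->
  (forall z, Y z -> ~ W z -> T (nbhd_at z) `<=` Y) ->
  connected_set (extension `&` Y).
Proof.
move=> [[y0 Yy0] Yc] TY.
have anchorY z t : Y z -> anchor z t -> (extension `&` Y) t.
  move=> Yz [[Wz ->]|[Wz Tt]]; first by split=> //; left.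
  split; last exact: TY Tt.
  by right; exists (nbhd_at z) => //; apply: adhesion_nbhd_at.
split; first by have [t ?] := anchor_exists y0; exists t; apply: anchorY Yy0 _.
have TJ z s t : Y z -> ~ W z -> T (nbhd_at z) s -> T (nbhd_at z) t ->
    joined (extension `&` Y) s t.
  move=> Yz Wz Ts Tt; have [_ [_ Tc] _ _] := TP (adhesion_nbhd_at Wz).
  apply: sub_joined (Tc s t Ts Tt) => w Tw; apply: (anchorY z) => //.
  by right.
have same z s t : Y z -> anchor z s -> anchor z t ->
    joined (extension `&` Y) s t.
  move=> Yz [[Wz ->]|[Wz Ts]] [[Wz' ->]|[Wz' Tt]] //; first exact: joined_refl.
  exact: TJ Ts Tt.
(* Here [a] belongs to the adhesion set of the component of [b], so the connector has a vertex
   adjacent to [a]. *)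
have into a b t : Y a -> Y b -> adj a b -> W a -> ~ W b -> T (nbhd_at b) t ->
    joined (extension `&` Y) a t.
  move=> Ya Yb ab Wa Wb Tt.
  have [_ _ Ta _] := TP (adhesion_nbhd_at Wb).
  have [|s Ts sa] := Ta a.
    by split; [case | exists b; [apply: comp_refl | apply: adj_sym]].
  apply: joined_trans (TJ b s t Yb Wb Ts Tt); apply: joined1; last exact: adj_sym.
    by split=> //; left.
  by apply: (anchorY b) => //; right.
have step a b s t : Y a -> Y b -> adj a b -> anchor a s -> anchor b t ->
    joined (extension `&` Y) s t.
  move=> Ya Yb ab [[Wa ->]|[Wa Ts]] [[Wb ->]|[Wb Tt]].
  - by apply: joined1 => //; split=> //; left.
  - exact: into Tt.
  - by apply: joined_sym; apply: into Ts => //; apply: adj_sym.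
  - have cab : comp (~` W) a b by split=> //; apply: joined1.
    by apply: (TJ a) => //; rewrite /nbhd_at (comp_eq cab).
move=> x y [/anchor_self xx Yx] [/anchor_self yy Yy].
have /(clos_rt_rtn1 _ _ _ _) xy : joined Y x y by apply: Yc.
(* The endpoint is generalized to any of its anchors, as inner vertices of the walk need not lie in
   the extension. *)
move: {2 3}y yy => t yt; elim: xy t yt => [t|a b [Ya Yb ab] _ IH t bt].
  exact: same.
have [s as_] := anchor_exists a.
exact: joined_trans (IH s as_) (step a b s t Ya Yb ab as_ bt).
Qed.

Lemma connected_extension_component U C : U `<=` W -> is_component (~` U) C ->
  extension `&` C !=set0 -> connected_set (extension `&` C).
Proof.
move=> UW cC neC; have [[w [Ww Cw]]|nW] := pselect (W `&` C !=set0).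
  apply: connected_extension.
    by split; [exists w | move=> x y; apply: component_joined cC].
  move=> z Cz Wz; have aF := adhesion_nbhd_at Wz.
  (* A walk in [C] from [z] to [w] has to leave the component of [z] in G - W. *)
  have [a Na Ca] : exists2 a, nbhd_at z a & C a.
    apply: contrapT => na.
    have [] : comp (~` W) z w; last by [].
    apply: (joined_closed _ (component_joined cC Cz Cw)); last exact: comp_refl.
    move=> a b za Ca Cb ab; apply: contrapT => zb; apply: na.
    by exists b => //; split=> //; exists a.
  (* The component [D] of the connector may not contain [z], but it also has [a] as a neighbor, so
     it meets [C] and hence lies in [C]. *)
  have [_ _ _ [D [cD ND TD]]] := TP aF.
  rewrite -ND in Na; have [_ [d Dd da]] := Na.
  have Cd : C d.
    apply: component_adj cC Ca _ (adj_sym da) => Ud.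
    exact: (component_sub cD Dd) (UW d Ud).
  exact: subset_trans TD (sub_component UW cC cD Cd Dd).
(* If [C] misses [W], it lies in a single component of G - W, and all its vertices in the extension
   belong to one connector, which is contained in [C]. *)
split=> // x y [ex Cx] [ey Cy].
have CW : C `<=` ~` W by move=> z Cz Wz; apply: nW; exists z.
have xy : comp (~` W) x y.
  by split; [exact: CW | exact: sub_joined CW (component_joined cC Cx Cy)].
have Tz z : extension z -> C z -> T (nbhd_at z) z.
  by move=> /anchor_self[[/CW]//|[]].
have Tx := Tz x ex Cx; have Ty := Tz y ey Cy.
rewrite /nbhd_at -(comp_eq xy) -/(nbhd_at x) in Ty.
have aF := adhesion_nbhd_at (CW x Cx).
have [_ [_ Tc] _ [D [cD ND TD]]] := TP aF.
apply: sub_joined (Tc x y Tx Ty) => z Tz'; split.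
  by right; exists (nbhd_at x).
exact: sub_component UW cC cD Cx (TD x Tx) z (TD z Tz').
Qed.

End Extension.
End Connecting.

Theorem theorem3p2 (G : sgraph) (U : set G)
    (G_connected : connected_set [set: G]) :
  (exists W : set G,
    [/\ is_envelope U W,
        connected_set W &
        forall C : set G, is_component (~` U) C ->
          W `&` C !=set0 -> connected_set (W `&` C)]) /\
  (concentrated U ->
   exists W : set G,
    [/\ is_envelope U W,
        connected_set W,
        forall C : set G, is_component (~` U) C ->
          W `&` C !=set0 -> connected_set (W `&` C) &
        concentrated W]).
Proof.
have [V [UV faV VU]] := finite_adhesion_exists U.
have [T TP] := connectors_exist faV.
pose W := extension V T.
have UW : U `<=` W by move=> u /UV; left.
have WU : closely_surrounds W U.
  exact: closely_surrounds_trans VU (surrounds_extension TP).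
have envW : is_envelope U W.
  split=> //; first exact: finite_adhesion_extension.
  exact: end_boundary_surrounds.
have cW : connected_set W.
  by rewrite -[W]setIT; apply: connected_extension.
have cWC C : is_component (~` U) C -> W `&` C !=set0 -> connected_set (W `&` C).
  exact: connected_extension_component.
split; first by exists W.
by move=> cU; exists W; split=> //; apply: concentrated_surrounds cU.
Qed.
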